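(* Let $(X,G)$ and $(Y,H)$ be CR-dynamical systems and suppose that $G$ and $H$ are topological conjugates. Then the following hold. (1) For each $k\in\{1,\infty,1^{\oplus},2^{\oplus},3^{\oplus},1^{\ominus},2^{\ominus},3^{\ominus},1^{\omega},2^{\omega},3^{\omega},1^{\alpha},2^{\alpha},3^{\alpha}\}$: $(X,G)$ is $k$-minimal if and only if $(Y,H)$ is $k$-minimal. (2) For each $k\in\{1,\infty\}$: $(X,G)$ is $k$-backward minimal if and only if $(Y,H)$ is $k$-backward minimal.
   Context: A CR-dynamical system is a pair $(X,G)$ where $X$ is a compact metric space and $G\subseteq X\times X$ is a non-empty closed subset. For CR-dynamical systems $(X,G)$ and $(Y,H)$, $G$ and $H$ are topological conjugates if there is a homeomorphism $\varphi:X\to Y$ such that for each $(x,y)\in X\times X$, $(x,y)\in G\Leftrightarrow(\varphi(x),\varphi(y))\in H$. $p_1(x,y)=x$ and $p_2(x,y)=y$ are the standard projections, $G^{-1}=\{(y,x):(x,y)\in G\}$, and $\mathrm{Cl}$ denotes closure in the space. For a CR-dynamical system $(X,G)$: Invariance: $A\subseteq X$ is $1$-invariant if for each $x\in A\cap p_1(G)$ there is $y\in A$ with $(x,y)\in G$; $\infty$-invariant if for each $(x,y)\in G$, $x\in A$ implies $y\in A$; $1$-backward invariant if for each $y\in A\cap p_2(G)$ there is $x\in A$ with $(x,y)\in G$; $\infty$-backward invariant if for each $(x,y)\in G$, $y\in A$ implies $x\in A$. For $k\in\{1,\infty\}$, $(X,G)$ is $k$-minimal (respectively $k$-backward minimal)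 if every closed subset $A$ of $X$ that is $k$-invariant (respectively $k$-backward invariant) satisfies $A\in\{\emptyset,X\}$. Orbits: for a relation $R$ on $X$, $\star_{i=1}^{\infty}R=\{(x_1,x_2,\ldots)\in\prod_{i=1}^\infty X : (x_i,x_{i+1})\in R \text{ for each } i\ge1\}$, with coordinate projections $\pi_k$. $T_G^{+}(x)=\{\mathbf x\in\star_{i=1}^{\infty}G : \pi_1(\mathbf x)=x\}$, $T_G^{-}(x)=\{\mathbf x\in\star_{i=1}^{\infty}G^{-1} : \pi_1(\mathbf x)=x\}$. For $\mathbf x\in\star_{i=1}^{\infty}G$: $\mathcal O_G^{\oplus}(\mathbf x)=\{\pi_k(\mathbf x): k\ge 1\}$, and $\omega_G(\mathbf x)$ is the set of limits in $X$ of convergent subsequences of the sequence $\mathbf x$. For $\mathbf x\in\star_{i=1}^{\infty}G^{-1}$: $\mathcal O_G^{\ominus}(\mathbf x)=\{\pi_k(\mathbf x): k\ge 1\}$, and $\alpha_G(\mathbf x)$ is the set of limits in $X$ of convergent subsequences of the sequence $\mathbf x$. For $x\in X$: $\mathcal U_G^{\oplus}(x)=\bigcup_{\mathbf x\in T_G^{+}(x)}\mathcal O_G^{\oplus}(\mathbf x)$, $\psi_G(x)=\bigcup_{\mathbf x\in T_G^{+}(x)}\omega_G(\mathbf x)$, $\mathcal U_G^{\ominus}(x)=\bigcup_{\mathbf x\in T_G^{-}(x)}\mathcal O_G^{\ominus}(\mathbf x)$, $\beta_G(x)=\bigcup_{\mathbf x\in T_G^{-}(x)}\alpha_G(\mathbf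 x)$. $(X,G)$ is: - $1^{\oplus}$-minimal if $T_G^{+}(x)\neq\emptyset$ for each $x\in X$ and $\mathrm{Cl}(\mathcal O_G^{\oplus}(\mathbf x))=X$ for each $\mathbf x\in\star_{i=1}^{\infty}G$; $2^{\oplus}$-minimal if for each $x\in X$ there is $\mathbf x\in T_G^{+}(x)$ with $\mathrm{Cl}(\mathcal O_G^{\oplus}(\mathbf x))=X$; $3^{\oplus}$-minimal if $\mathrm{Cl}(\mathcal U_G^{\oplus}(x))=X$ for each $x\in X$; - $1^{\ominus}$-minimal if $T_G^{-}(x)\neq\emptyset$ for each $x\in X$ and $\mathrm{Cl}(\mathcal O_G^{\ominus}(\mathbf x))=X$ for each $\mathbf x\in\star_{i=1}^{\infty}G^{-1}$; $2^{\ominus}$-minimal if for each $x\in X$ there is $\mathbf x\in T_G^{-}(x)$ with $\mathrm{Cl}(\mathcal O_G^{\ominus}(\mathbf x))=X$; $3^{\ominus}$-minimal if $\mathrm{Cl}(\mathcal U_G^{\ominus}(x))=X$ for each $x\in X$; - $1^{\omega}$-minimal if $T_G^{+}(x)\neq\emptyset$ for each $x\in X$ and $\omega_G(\mathbf x)=X$ for each $\mathbf x\in\star_{i=1}^{\infty}G$; $2^{\omega}$-minimal if for each $x\in X$ there is $\mathbf x\in T_G^{+}(x)$ with $\omega_G(\mathbf x)=X$; $3^{\omega}$-minimal if $\psi_G(x)=X$ for each $x\in X$; - $1^{\alpha}$-minimal if $T_G^{-}(x)\neq\emptyset$ for each $x\in X$ and $\alpha_G(\mathbf x)=X$ for each $\mathbf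 x\in\star_{i=1}^{\infty}G^{-1}$; $2^{\alpha}$-minimal if for each $x\in X$ there is $\mathbf x\in T_G^{-}(x)$ with $\alpha_G(\mathbf x)=X$; $3^{\alpha}$-minimal if $\beta_G(x)=X$ for each $x\in X$. *)

(* Defs.v *)
From mathcomp Require Import all_boot all_order all_algebra.
From mathcomp Require Import all_classical all_reals all_analysis.

Set Implicit Arguments.
Unset Strict Implicit.
Unset Printing Implicit Defensive.

Local Open Scope classical_set_scope.
Local Open Scope relation_scope.

(* Sequences are indexed from 0, so the projection \pi_k is u |-> u k.-1.
   In relation_scope, G^-1 is the opposite relation [set xy | G (xy.2, xy.1)]. *)

Definition CR_system (R : realType) (X : metricType R) (G : set (X * X)) : Prop :=
  [/\ compact [set: X], closed G & G !=set0].

Definition homeomorphism (X Y : topologicalType) (f : X -> Y) : Prop :=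
  exists g : Y -> X,
    [/\ cancel f g, cancel g f, continuous f & continuous g].

Definition topological_conjugates (X Y : topologicalType)
    (G : set (X * X)) (H : set (Y * Y)) : Prop :=
  exists2 phi : X -> Y, homeomorphism phi &
    forall x y : X, G (x, y) <-> H (phi x, phi y).

Section Invariance.
Variables (X : topologicalType) (G : set (X * X)).
Implicit Types A : set X.

Definition invariant1 A : Prop :=
  forall x, (A `&` fst @` G) x -> exists2 y, A y & G (x, y).

Definition invariantoo A : Prop :=
  forall x y, G (x, y) -> A x -> A y.

Definition backward_invariant1 A : Prop :=
  forall y, (A `&` snd @` G) y -> exists2 x, A x & G (x, y).

Definition backward_invariantoo A : Prop :=
  forall x y, G (x, y) -> A y -> A x.

Definition minimal_for (P : set X -> Prop) : Prop :=
  forall A, closed A -> P A -> A = set0 \/ A = [set: X].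

End Invariance.

Section Orbits.
Variable X : topologicalType.
Implicit Types (G : set (X * X)) (x : X) (u : nat -> X).

Definition star G : set (nat -> X) := [set u | forall i, G (u i, u i.+1)].

Definition Tplus G x : set (nat -> X) := [set u | star G u /\ u 0%N = x].

Definition Tminus G x : set (nat -> X) := [set u | star G^-1 u /\ u 0%N = x].

(* Both the forward and the backward orbit set of a sequence. *)
Definition orbit_set u : set X := range u.

(* Both \omega_G(u), for u in star G, and \alpha_G(u), for u in star G^-1. *)
Definition limit_set u : set X :=
  [set y | exists2 s : nat -> nat, increasing_seq s & u \o s @ \oo --> y].

Definition Uplus G x : set X := \bigcup_(u in Tplus G x) orbit_set u.

Definition Uminus G x : set X := \bigcup_(u in Tminus G x) orbit_set u.

Definition psi G x : set X := \bigcup_(u in Tplus G x) limit_set u.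

Definition beta G x : set X := \bigcup_(u in Tminus G x) limit_set u.

End Orbits.

Variant minimality :=
  | M1 | Moo
  | M1oplus | M2oplus | M3oplus
  | M1ominus | M2ominus | M3ominus
  | M1omega | M2omega | M3omega
  | M1alpha | M2alpha | M3alpha.

Variant backward_minimality := B1 | Boo.

Definition minimal (X : topologicalType) (k : minimality) (G : set (X * X)) :
    Prop :=
  match k with
  | M1 => minimal_for (invariant1 G)
  | Moo => minimal_for (invariantoo G)
  | M1oplus => (forall x, Tplus G x !=set0) /\
      (forall u, star G u -> closure (orbit_set u) = [set: X])
  | M2oplus => forall x, exists2 u, Tplus G x u &
      closure (orbit_set u) = [set: X]
  | M3oplus => forall x, closure (Uplus G x) = [set: X]
  | M1ominus => (forall x, Tminus G x !=set0) /\
      (forall u, star G^-1 u -> closure (orbit_set u) = [set: X])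
  | M2ominus => forall x, exists2 u, Tminus G x u &
      closure (orbit_set u) = [set: X]
  | M3ominus => forall x, closure (Uminus G x) = [set: X]
  | M1omega => (forall x, Tplus G x !=set0) /\
      (forall u, star G u -> limit_set u = [set: X])
  | M2omega => forall x, exists2 u, Tplus G x u & limit_set u = [set: X]
  | M3omega => forall x, psi G x = [set: X]
  | M1alpha => (forall x, Tminus G x !=set0) /\
      (forall u, star G^-1 u -> limit_set u = [set: X])
  | M2alpha => forall x, exists2 u, Tminus G x u & limit_set u = [set: X]
  | M3alpha => forall x, beta G x = [set: X]
  end.

Definition backward_minimal (X : topologicalType) (k : backward_minimality)
    (G : set (X * X)) : Prop :=
  match k with
  | B1 => minimal_for (backward_invariant1 G)
  | Boo => minimal_for (backward_invariantoo G)
  end.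

(* Main.v *)
(** A conjugacy [phi] carries [G]-orbits onto [H]-orbits and, being continuous,
    carries limit points and dense sets to limit points and dense sets, while
    preimages under [phi] preserve closedness and invariance. So each kind of
    minimality passes from [G] to [H], and the converse follows by exchanging
    the roles of [G] and [H]. The backward notions are the forward notions of
    the opposite relation, which is conjugated by the same [phi]. *)

Require Import Defs.
From mathcomp Require Import all_boot all_order all_algebra.
From mathcomp Require Import all_classical all_reals all_analysis.

Set Implicit Arguments.
Unset Strict Implicit.
Unset Printing Implicit Defensive.

Local Open Scope classical_set_scope.
Local Open Scope relation_scope.

Lemma topological_conjugates_sym (X Y : topologicalType)
    (G : set (X * X)) (H : set (Y * Y)) :
  topological_conjugates G H -> topological_conjugates H G.
Proof.
move=> [f [g [fK gK cf cg]] GH]; exists g; first by exists f.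
by move=> x y; rewrite GH !gK.
Qed.

Lemma topological_conjugates_inv (X Y : topologicalType)
    (G : set (X * X)) (H : set (Y * Y)) :
  topological_conjugates G H -> topological_conjugates G^-1 H^-1.
Proof. by move=> [f hf GH]; exists f => // x y; exact: GH. Qed.

(** Swapping the entries of a pair turns [snd @] G[into]fst @[G^-1], so the domain condition matches
    as well as the successor condition. *)
Lemma backward_invariant1E (X : topologicalType) (G : set (X * X)) :
  backward_invariant1 G = invariant1 G^-1.
Proof.
apply/funext => A; apply/propext; split=> invA y [Ay [[a b] Gab /= aby]];
  apply: invA; split=> //; exists (b, a) => //.
Qed.

Lemma backward_invariantooE (X : topologicalType) (G : set (X * X)) :
  backward_invariantoo G = invariantoo G^-1.
Proof. by apply/funext => A; apply/propext; split=> invA x y; exact: invA. Qed.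

(** A neighbourhood of [f x] pulls back to a neighbourhood of [x], which meets the dense set [A]. *)
Lemma closure_image_dense (X Y : topologicalType) (f : X -> Y) (A : set X) :
  continuous f -> range f = [set: Y] ->
  closure A = [set: X] -> closure (f @` A) = [set: Y].
Proof.
move=> cf surjf dA; apply/seteqP; split=> // y _.
have [x _ <-] : range f y by rewrite surjf.
move=> B /cf fB.
have : closure A x by rewrite dA.
by move=> /(_ _ fB) [a [Aa Ba]]; exists (f a); split=> //; exists a.
Qed.

(** The same index subsequence [s] serves on both sides. *)
Lemma limit_set_image (X Y : topologicalType) (f : X -> Y) (u : nat -> X) :
  continuous f -> f @` limit_set u `<=` limit_set (f \o u).
Proof.
move=> cf _ [x [s sincr us] <-]; exists s => //.
exact: cvg_comp us (cf x).
Qed.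

Section ConjugateTransfer.
Variables (X Y : topologicalType) (G : set (X * X)) (H : set (Y * Y)).
Variables (f : X -> Y) (g : Y -> X).
Hypotheses (gK : cancel g f) (cf : continuous f).
Hypothesis GH : forall x y, G (x, y) <-> H (f x, f y).

Lemma range_conj : range f = [set: Y].
Proof. by apply/seteqP; split=> // y _; exists (g y). Qed.

(** Limit sets and [psi] are required to be the whole space without taking closures; by surjectivity
    an inclusion of images suffices for them. *)
Lemma image_conj_sub_eqT (A : set X) (B : set Y) :
  f @` A `<=` B -> A = [set: X] -> B = [set: Y].
Proof.
by move=> fAB AT; apply/seteqP; split=> // y _; apply: fAB; rewrite AT range_conj.
Qed.

Lemma star_conj (u : nat -> X) : star G u -> star H (f \o u).
Proof. by move=> Gu i; apply/GH/Gu. Qed.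

Lemma star_conjV (v : nat -> Y) : star H v -> star G (g \o v).
Proof. by move=> Hv i; apply/GH; rewrite /= !gK. Qed.

Lemma Tplus_conj (x : X) (u : nat -> X) :
  Tplus G x u -> Tplus H (f x) (f \o u).
Proof. by move=> [/star_conj Hu <-]. Qed.

Lemma star_conjK (v : nat -> Y) : f \o (g \o v) = v.
Proof. by apply/funext => i /=; rewrite gK. Qed.

(** Every [H]-orbit [v] is the image of the [G]-orbit [g \o v]. Keeping [P] and [Q] abstract covers
    dense orbits and full limit sets at once. *)
Lemma all_star_conj (P : set (nat -> X)) (Q : set (nat -> Y)) :
  (forall u, P u -> Q (f \o u)) ->
  (forall x, Tplus G x !=set0) /\ (forall u, star G u -> P u) ->
  (forall y, Tplus H y !=set0) /\ (forall v, star H v -> Q v).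
Proof.
move=> PQ [G0 GP]; split=> [y|v Hv].
  by have [u Gu] := G0 (g y); exists (f \o u); rewrite -(gK y); exact: Tplus_conj.
by rewrite -(star_conjK v); apply/PQ/GP/star_conjV.
Qed.

Lemma exists_Tplus_conj (P : set (nat -> X)) (Q : set (nat -> Y)) :
  (forall u, P u -> Q (f \o u)) ->
  (forall x, exists2 u, Tplus G x u & P u) ->
  forall y, exists2 v, Tplus H y v & Q v.
Proof.
move=> PQ GP y; have [u Gu Pu] := GP (g y).
by exists (f \o u); [rewrite -(gK y); exact: Tplus_conj | exact: PQ].
Qed.

Lemma Uplus_conj (x : X) : f @` Uplus G x `<=` Uplus H (f x).
Proof.
move=> _ [_ [u Gu [i _ <-]] <-].
by exists (f \o u); [exact: Tplus_conj | exists i].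
Qed.

Lemma psi_conj (x : X) : f @` psi G x `<=` psi H (f x).
Proof.
move=> _ [y [u Gu uy] <-]; exists (f \o u); first exact: Tplus_conj.
by apply: limit_set_image => //; exists y.
Qed.

Lemma closure_orbit_conj (u : nat -> X) :
  closure (orbit_set u) = [set: X] -> closure (orbit_set (f \o u)) = [set: Y].
Proof.
rewrite /orbit_set -(image_comp u f).
by move=> /(closure_image_dense cf range_conj).
Qed.

Lemma limit_set_conj (u : nat -> X) :
  limit_set u = [set: X] -> limit_set (f \o u) = [set: Y].
Proof. by apply: image_conj_sub_eqT; exact: limit_set_image. Qed.

Lemma closure_Uplus_conj :
  (forall x, closure (Uplus G x) = [set: X]) ->
  forall y, closure (Uplus H y) = [set: Y].
Proof.
move=> GT y; apply/seteqP; split=> //.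
rewrite -(closure_image_dense cf range_conj (GT (g y))).
(* Only the base point of [Uplus H y] becomes [f (g y)]; the other [y] sits inside [g y]. *)
by apply: closure_subset; rewrite -{2}(gK y); exact: Uplus_conj.
Qed.

Lemma psi_conjT :
  (forall x, psi G x = [set: X]) -> forall y, psi H y = [set: Y].
Proof.
by move=> GT y; rewrite -(gK y); exact: image_conj_sub_eqT (@psi_conj _) (GT _).
Qed.

(** The preimage of [B] is closed and satisfies [P], hence is empty or everything; evaluating it at
    [g y] decides whether [y] lies in [B]. *)
Lemma minimal_for_preimage (P : set X -> Prop) (Q : set Y -> Prop) :
  (forall B, Q B -> P (f @^-1` B)) -> minimal_for P -> minimal_for Q.
Proof.
move=> QP minP B clB QB.
have [||B0|BT] := minP (f @^-1` B); last 2 first.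
- left; apply/seteqP; split=> // y By.
  by have : (f @^-1` B) (g y); [rewrite /= gK | rewrite B0].
- right; apply/seteqP; split=> // y _.
  by have : (f @^-1` B) (g y); [rewrite BT | rewrite /= gK].
- by apply: closed_comp => // x _; exact: cf.
- exact: QP.
Qed.

Lemma invariant1_preimage (B : set Y) :
  invariant1 H B -> invariant1 G (f @^-1` B).
Proof.
move=> invB x [Bx [[a z] Gxz /= ax]]; rewrite {a}ax in Gxz.
have [|y By Hxy] := invB (f x).
  by split=> //; exists (f x, f z) => //; exact/GH.
(* The successor [y] of [f x] found in [B] is pulled back along [g]. *)
by exists (g y); rewrite /= ?gK//; apply/GH; rewrite gK.
Qed.

Lemma invariantoo_preimage (B : set Y) :
  invariantoo H B -> invariantoo G (f @^-1` B).
Proof. by move=> invB x y /GH; exact: invB. Qed.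

End ConjugateTransfer.

Lemma minimal_conj (X Y : topologicalType) (G : set (X * X)) (H : set (Y * Y))
    (k : minimality) :
  topological_conjugates G H -> minimal k G -> minimal k H.
Proof.
move=> GH; have GHV := topological_conjugates_inv GH.
move: GH => [f [g [_ gK cf _]] GH].
(* Membership in the opposite relations unfolds to [GH] at the swapped pair, so the transfer lemmas
   apply to them with the same [f] and [g]. *)
have GHV' x y : G^-1 (x, y) <-> H^-1 (f x, f y) by exact: GH.
have orb u := closure_orbit_conj gK cf (u := u).
have lim u := limit_set_conj gK cf (u := u).
case: k => /=.
- exact: (minimal_for_preimage gK cf (invariant1_preimage gK GH)).
- exact: (minimal_for_preimage gK cf (invariantoo_preimage GH)).
- exact: (all_star_conj gK GH orb).
- exact: (exists_Tplus_conj gK GH orb).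
- exact: (closure_Uplus_conj gK cf GH).
- exact: (all_star_conj gK GHV' orb).
- exact: (exists_Tplus_conj gK GHV' orb).
- exact: (closure_Uplus_conj gK cf GHV').
- exact: (all_star_conj gK GH lim).
- exact: (exists_Tplus_conj gK GH lim).
- exact: (psi_conjT gK cf GH).
- exact: (all_star_conj gK GHV' lim).
- exact: (exists_Tplus_conj gK GHV' lim).
- exact: (psi_conjT gK cf GHV').
Qed.

Lemma backward_minimal_conj (X Y : topologicalType)
    (G : set (X * X)) (H : set (Y * Y)) (k : backward_minimality) :
  topological_conjugates G H -> backward_minimal k G -> backward_minimal k H.
Proof.
move=> /topological_conjugates_inv GH.
case: k => /=; rewrite ?backward_invariant1E ?backward_invariantooE.
- exact: (@minimal_conj _ _ _ _ M1 GH).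
- exact: (@minimal_conj _ _ _ _ Moo GH).
Qed.

Theorem theorem9p7 (R : realType) (X Y : metricType R)
    (G : set (X * X)) (H : set (Y * Y))
    (GX : CR_system G) (HY : CR_system H)
    (GH : topological_conjugates G H) :
  (forall k : minimality, minimal k G <-> minimal k H) /\
  (forall k : backward_minimality, backward_minimal k G <-> backward_minimal k H).
Proof.
have HG := topological_conjugates_sym GH.
by split=> k; split; (exact: minimal_conj || exact: backward_minimal_conj).
Qed.
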